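(* For every $\gamma \ge 1$ there exist constants $c_0, c_1, c_2 > 0$ (positive integers) depending only on $\gamma$ such that the following holds. Let $N_1,N_2,m,r$ be positive integers and let $\mathcal{A}: \mathbb{R}^{N_1 \times N_2} \to \mathbb{R}^m$ be a linear map satisfying the modified rank-restricted isometry property of order $c_0 r$ with ratio $\gamma_{c_0 r} \le \gamma$. Then any matrix $\mathbf{X} \in \mathbb{R}^{N_1 \times N_2}$ of rank at most $r$ acquired by $\mathbf{y} = \mathcal{A}(\mathbf{X})$ is exactly recovered as the limit of the sequence $(\mathbf{X}_n)_{n \ge 0}$ defined by $\mathbf{X}_0 = \mathbf{0}$ and $$\mathbf{X}_{n+1} = H_s\big( \mathbf{X}_n + \mu_n H_t( \mathcal{A}^* \mathrm{sgn}(\mathbf{y}-\mathcal{A} \mathbf{X}_n) ) \big), \qquad n \ge 0,$$ with parameters $s = c_1 r$, $t = c_2 r$, and $$\mu_n = \frac{\|\mathbf{y} - \mathcal{A} \mathbf{X}_n\|_1}{\| H_t(\mathcal{A}^* \mathrm{sgn}(\mathbf{y}-\mathcal{A} \mathbf{X}_n)) \|_F^2};$$ that is, $\lim_{n\to\infty} \mathbf{X}_n = \mathbf{X}$.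
   Context: $\|\cdot\|_F$ is the Frobenius norm with inner product $\langle\cdot,\cdot\rangle_F$, and $\|\cdot\|_1$ is the $\ell_1$-norm on $\mathbb{R}^m$. $\mathcal{A}\mathbf{Z}$ means $\mathcal{A}(\mathbf{Z})$. The adjoint $\mathcal{A}^*:\mathbb{R}^m \to \mathbb{R}^{N_1\times N_2}$ is defined by $\langle \mathcal{A}^*(\mathbf{u}), \mathbf{Z}\rangle_F = \langle \mathbf{u}, \mathcal{A}(\mathbf{Z})\rangle$ for all $\mathbf{u}\in\mathbb{R}^m$, $\mathbf{Z}\in\mathbb{R}^{N_1\times N_2}$. The function $\mathrm{sgn}$ is applied entrywise, with $\mathrm{sgn}(0)=0$. Let $N=\min\{N_1,N_2\}$. For a matrix $\mathbf{Z}$ with singular value decomposition $\mathbf{Z}=\sum_{\ell=1}^N \sigma_\ell(\mathbf{Z})\mathbf{u}_\ell\mathbf{v}_\ell^*$, $\sigma_1(\mathbf{Z})\ge\cdots\ge\sigma_N(\mathbf{Z})\ge 0$, put $H_k(\mathbf{Z})=\sum_{\ell=1}^k \sigma_\ell(\mathbf{Z})\mathbf{u}_\ell\mathbf{v}_\ell^*$, a best approximation to $\mathbf{Z}$ by matrices of rank at most $k$ (if the singular value decomposition is not unique, one is chosen for each matrix); $H_k(\mathbf{Z})=\mathbf{Z}$ if $k\ge N$. Modified rank-restricted isometry property: for a positive integer $k$, $\mathcal{A}$ satisfies it at order $k$ if there are $\alpha,\beta>0$ such that $\alpha\|\mathbf{Z}\|_F \le \|\mathcal{A}(\mathbf{Z})\|_1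 \le \beta\|\mathbf{Z}\|_F$ for all $\mathbf{Z}\in\mathbb{R}^{N_1\times N_2}$ with $\mathrm{rank}(\mathbf{Z})\le k$. The optimal such constants (largest $\alpha$, smallest $\beta$) are denoted $\alpha_k,\beta_k$, and the ratio is $\gamma_k = \beta_k/\alpha_k\ge 1$. Convention: if $H_t(\mathcal{A}^* \mathrm{sgn}(\mathbf{y}-\mathcal{A} \mathbf{X}_n))=\mathbf{0}$, so that $\mu_n$ is not defined by its formula, the update term $\mu_n H_t(\cdots)$ is taken to be $\mathbf{0}$, so $\mathbf{X}_{n+1}=\mathbf{X}_n$. *)

(* Defs.v *)
From HB Require Import structures.
From mathcomp Require Import all_boot all_order all_algebra.
From mathcomp Require Import all_classical all_reals all_analysis.

Set Implicit Arguments.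
Unset Strict Implicit.
Unset Printing Implicit Defensive.

Import Order.TTheory GRing.Theory Num.Theory.
Import numFieldNormedType.Exports.

Local Open Scope classical_set_scope.
Local Open Scope ring_scope.

(* On column vectors ([q = 1]) this is the usual inner product of R^p. *)
Definition frob_inner (R : realType) (p q : nat) (Y Z : 'M[R]_(p, q)) : R :=
  \sum_(i < p) \sum_(j < q) Y i j * Z i j.

Definition frob_norm (R : realType) (p q : nat) (Z : 'M[R]_(p, q)) : R :=
  Num.sqrt (frob_inner Z Z).

Definition l1_norm (R : realType) (m : nat) (u : 'cV[R]_m) : R :=
  \sum_(i < m) `|u i 0|.

(* [Num.sg 0 = 0]. *)
Definition sgn (R : realType) (m : nat) (u : 'cV[R]_m) : 'cV[R]_m :=
  map_mx Num.sg u.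

Definition is_adjoint (R : realType) (N1 N2 m : nat)
    (A : 'M[R]_(N1, N2) -> 'cV[R]_m) (Aadj : 'cV[R]_m -> 'M[R]_(N1, N2)) :=
  forall (u : 'cV[R]_m) (Z : 'M[R]_(N1, N2)),
    frob_inner (Aadj u) Z = frob_inner u (A Z).

(* The singular vectors are the columns of [svd_left] and [svd_right]; indices
   start at 0, so the [l]-th entry of [svd_val] is sigma_(l+1)(Z). *)
Record svd (R : realType) (N1 N2 : nat) (Z : 'M[R]_(N1, N2)) := SVD {
  svd_val : 'rV[R]_(minn N1 N2);
  svd_left : 'M[R]_(N1, minn N1 N2);
  svd_right : 'M[R]_(N2, minn N1 N2);
  svd_val_ge0 : forall l : 'I_(minn N1 N2), 0 <= svd_val 0 l;
  svd_val_noninc : forall l l' : 'I_(minn N1 N2),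
    (l <= l')%N -> svd_val 0 l' <= svd_val 0 l;
  svd_left_orthonormal : svd_left^T *m svd_left = 1%:M;
  svd_right_orthonormal : svd_right^T *m svd_right = 1%:M;
  svd_eq : Z = \sum_(l < minn N1 N2)
    svd_val 0 l *: (col l svd_left *m (col l svd_right)^T)
}.

(* [S] is the choice of one singular value decomposition for each matrix. For
   [minn N1 N2 <= k] the sum has all its terms, so [hard_thr S k Z = Z]. *)
Definition hard_thr (R : realType) (N1 N2 : nat)
    (S : forall Z : 'M[R]_(N1, N2), svd Z) (k : nat) (Z : 'M[R]_(N1, N2)) :
    'M[R]_(N1, N2) :=
  \sum_(l < minn N1 N2 | (l < k)%N)
    svd_val (S Z) 0 l *: (col l (svd_left (S Z)) *m (col l (svd_right (S Z)))^T).

Definition rip_lower (R : realType) (N1 N2 m : nat)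
    (A : 'M[R]_(N1, N2) -> 'cV[R]_m) (k : nat) : set R :=
  [set a | 0 < a /\ forall Z : 'M[R]_(N1, N2), (\rank Z <= k)%N ->
             a * frob_norm Z <= l1_norm (A Z)].

Definition rip_upper (R : realType) (N1 N2 m : nat)
    (A : 'M[R]_(N1, N2) -> 'cV[R]_m) (k : nat) : set R :=
  [set b | 0 < b /\ forall Z : 'M[R]_(N1, N2), (\rank Z <= k)%N ->
             l1_norm (A Z) <= b * frob_norm Z].

Definition rank_rip (R : realType) (N1 N2 m : nat)
    (A : 'M[R]_(N1, N2) -> 'cV[R]_m) (k : nat) : Prop :=
  exists a b : R, rip_lower A k a /\ rip_upper A k b.

(* Under [rank_rip A k], with [N1], [N2] and [k] positive, the supremum and the
   infimum below are attained: they are the largest and smallest constants. *)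
Definition rip_alpha (R : realType) (N1 N2 m : nat)
    (A : 'M[R]_(N1, N2) -> 'cV[R]_m) (k : nat) : R := sup (rip_lower A k).

Definition rip_beta (R : realType) (N1 N2 m : nat)
    (A : 'M[R]_(N1, N2) -> 'cV[R]_m) (k : nat) : R := inf (rip_upper A k).

Definition rip_ratio (R : realType) (N1 N2 m : nat)
    (A : 'M[R]_(N1, N2) -> 'cV[R]_m) (k : nat) : R :=
  rip_beta A k / rip_alpha A k.

Section IterativeHardThresholding.
Variables (R : realType) (N1 N2 m : nat).
Variables (A : 'M[R]_(N1, N2) -> 'cV[R]_m) (Aadj : 'cV[R]_m -> 'M[R]_(N1, N2)).
Variables (S : forall Z : 'M[R]_(N1, N2), svd Z) (y : 'cV[R]_m) (s t : nat).

Definition iht_dir (Z : 'M[R]_(N1, N2)) : 'M[R]_(N1, N2) :=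
  hard_thr S t (Aadj (sgn (y - A Z))).

Definition iht_step (Z : 'M[R]_(N1, N2)) : R :=
  l1_norm (y - A Z) / frob_norm (iht_dir Z) ^+ 2.

(* When [iht_dir Z = 0] the update [iht_step Z *: iht_dir Z] is 0, whatever the
   junk value of [iht_step Z]. *)
Fixpoint iht (n : nat) : 'M[R]_(N1, N2) :=
  if n is n'.+1 then
    hard_thr S s (iht n' + iht_step (iht n') *: iht_dir (iht n'))
  else 0.

End IterativeHardThresholding.

(* Main.v *)
(** Write Z = X - X_n, G = A^* sgn(A Z), so that <G, Z> = |A Z|_1, and
    U = X_n + mu_n H_t(G). Both X and X_n have low rank, so the isometry property
    applies to Z and to H_t(G).
    - Since |H_t(G)|^2 = <sgn(A Z), A H_t(G)>, one has |H_t(G)| <= beta.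
    - If t is large compared with rank Z, the tail G - H_t(G), whose singular
      values are at most |H_t(G)| / sqrt t, has an inner product with Z of at most
      |A Z|_1 / 4. Hence the choice of mu_n yields
      |X - U|^2 <= |Z|^2 - |A Z|_1^2 / (2 |H_t(G)|^2)
                <= (1 - 1 / (2 gamma^2)) |Z|^2.
    - If s is large compared with r, then H_s(U) is nearly as close to X as U is:
      |X - H_s(U)|^2 <= (1 + eta) / (1 - eta) |X - U|^2 with
      eta^2 (s - r) >= r. With P the projection onto the column space of X, the
      reason is that <X, U - H_s(U)> = <X - H_s(U), P (U - H_s(U))>.
    With eta = 1 / (8 gamma^2) the error decreases geometrically. *)

Require Import Defs.
From HB Require Import structures.
From mathcomp Require Import all_boot all_order all_algebra.
From mathcomp Require Import zify ring lra.
From mathcomp Require Import all_classical all_reals all_analysis.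

Set Implicit Arguments.
Unset Strict Implicit.
Unset Printing Implicit Defensive.

Import Order.TTheory GRing.Theory Num.Theory.
Import numFieldNormedType.Exports.

Local Open Scope classical_set_scope.
Local Open Scope ring_scope.

(** * The Frobenius inner product *)

Local Notation sqnorm Z := (frob_inner Z Z).

Section Frobenius.
Variable R : realType.

Lemma frob_innerE p q (Y Z : 'M[R]_(p, q)) : frob_inner Y Z = \tr (Y^T *m Z).
Proof.
rewrite /frob_inner exchange_big; apply: eq_bigr => j _.
by rewrite mxE; apply: eq_bigr => i _; rewrite mxE.
Qed.

Lemma frob_innerC p q (Y Z : 'M[R]_(p, q)) : frob_inner Y Z = frob_inner Z Y.
Proof. by do 2!apply: eq_bigr => ? _; rewrite mulrC. Qed.

Lemma frob_innerDr p q (Y Z Z' : 'M[R]_(p, q)) :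
  frob_inner Y (Z + Z') = frob_inner Y Z + frob_inner Y Z'.
Proof. by rewrite !frob_innerE mulmxDr mxtraceD. Qed.

Lemma frob_innerZr p q (Y Z : 'M[R]_(p, q)) c :
  frob_inner Y (c *: Z) = c * frob_inner Y Z.
Proof. by rewrite !frob_innerE -scalemxAr mxtraceZ. Qed.

Lemma frob_innerNr p q (Y Z : 'M[R]_(p, q)) :
  frob_inner Y (- Z) = - frob_inner Y Z.
Proof. by rewrite -scaleN1r frob_innerZr mulN1r. Qed.

Lemma frob_innerDl p q (Y Z Z' : 'M[R]_(p, q)) :
  frob_inner (Z + Z') Y = frob_inner Z Y + frob_inner Z' Y.
Proof. by rewrite !(frob_innerC _ Y) frob_innerDr. Qed.

Lemma frob_innerZl p q (Y Z : 'M[R]_(p, q)) c :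
  frob_inner (c *: Z) Y = c * frob_inner Z Y.
Proof. by rewrite !(frob_innerC _ Y) frob_innerZr. Qed.

Lemma frob_innerNl p q (Y Z : 'M[R]_(p, q)) :
  frob_inner (- Z) Y = - frob_inner Z Y.
Proof. by rewrite !(frob_innerC _ Y) frob_innerNr. Qed.

Definition frob_bilin := (frob_innerDl, frob_innerDr, frob_innerZl,
  frob_innerZr, frob_innerNl, frob_innerNr).

Lemma frob_inner_mull p q k (P : 'M[R]_(p, q)) (Y : 'M[R]_(q, k)) Z :
  frob_inner (P *m Y) Z = frob_inner Y (P^T *m Z).
Proof. by rewrite !frob_innerE trmx_mul mulmxA. Qed.

Lemma frob_inner_mulr p q k (Y : 'M[R]_(p, q)) (Q : 'M[R]_(q, k)) Z :
  frob_inner (Y *m Q) Z = frob_inner Y (Z *m Q^T).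
Proof.
by rewrite !frob_innerE trmx_mul -mulmxA mxtrace_mulC mulmxA.
Qed.

Lemma sqnorm_ge0 p q (Z : 'M[R]_(p, q)) : 0 <= sqnorm Z.
Proof. by do 2!apply: sumr_ge0 => ? _; rewrite -expr2 sqr_ge0. Qed.

Lemma sqr_entry_le_sqnorm p q (Z : 'M[R]_(p, q)) i j : Z i j ^+ 2 <= sqnorm Z.
Proof.
rewrite /frob_inner (bigD1 i) //= (bigD1 j) //= -expr2 -addrA lerDl.
rewrite addr_ge0 //; first by apply: sumr_ge0 => ? _; rewrite -expr2 sqr_ge0.
by do 2!apply: sumr_ge0 => ? _; rewrite -expr2 sqr_ge0.
Qed.

Lemma sqnorm_eq0 p q (Z : 'M[R]_(p, q)) : sqnorm Z = 0 -> Z = 0.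
Proof.
move=> Z0; apply/matrixP => i j; rewrite mxE; apply/eqP.
by rewrite -sqrf_eq0 eq_le sqr_ge0 andbT -Z0 sqr_entry_le_sqnorm.
Qed.

Lemma sqr_frob_norm p q (Z : 'M[R]_(p, q)) : frob_norm Z ^+ 2 = sqnorm Z.
Proof. by rewrite sqr_sqrtr ?sqnorm_ge0. Qed.

Lemma frob_norm_ge0 p q (Z : 'M[R]_(p, q)) : 0 <= frob_norm Z.
Proof. exact: sqrtr_ge0. Qed.

Lemma frob_norm0 p q : frob_norm (0 : 'M[R]_(p, q)) = 0.
Proof.
by rewrite /frob_norm -(scale0r 0) frob_innerZl mul0r sqrtr0.
Qed.

Lemma frob_norm_gt0 p q (Z : 'M[R]_(p, q)) : (0 < frob_norm Z) = (Z != 0).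
Proof.
have [->|Z0] := eqVneq Z 0; first by rewrite frob_norm0 ltxx.
rewrite lt0r frob_norm_ge0 andbT; apply: contra_neq Z0 => Z0.
by apply: sqnorm_eq0; rewrite -sqr_frob_norm Z0 expr0n.
Qed.

(** Expand the squared norm of [c *: Y - Z], which is nonnegative, and divide by [c]. The weight
    [|Z| / |Y|] gives Cauchy-Schwarz; the weight [eta] serves the thresholding estimate. *)
Lemma frob_inner_le_weighted p q (Y Z : 'M[R]_(p, q)) c : 0 < c ->
  2 * frob_inner Y Z <= c * sqnorm Y + c^-1 * sqnorm Z.
Proof.
move=> c0; have := sqnorm_ge0 (c *: Y - Z).
rewrite !frob_bilin (frob_innerC Z Y) => H.
rewrite -(ler_pM2l c0) mulrDr (mulrA c c^-1) divff ?gt_eqF // mul1r.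
lra.
Qed.

Lemma frob_cauchy_schwarz p q (Y Z : 'M[R]_(p, q)) :
  frob_inner Y Z <= frob_norm Y * frob_norm Z.
Proof.
have [->|] := eqVneq Y 0.
  by rewrite frob_norm0 mul0r -(scale0r 0) frob_innerZl mul0r.
rewrite -frob_norm_gt0 => Y0.
have [->|] := eqVneq Z 0.
  by rewrite frob_norm0 mulr0 -(scale0r 0) frob_innerZr mul0r.
rewrite -frob_norm_gt0 => Z0.
have := frob_inner_le_weighted Y Z (divr_gt0 Z0 Y0).
rewrite -!sqr_frob_norm invf_div.
set a := frob_norm Y in Y0 *; set b := frob_norm Z in Z0 *.
have -> : b / a * a ^+ 2 + a / b * b ^+ 2 = 2 * (a * b).
  by field; rewrite !gt_eqF.
by rewrite ler_pM2l.
Qed.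

(** * Orthonormal columns, projections and diagonal factors *)

Lemma sqnorm_mul_trl p q k (L : 'M[R]_(p, q)) (B : 'M[R]_(q, k)) :
  L^T *m L = 1%:M -> sqnorm (L *m B) = sqnorm B.
Proof. by move=> LL; rewrite frob_inner_mull mulmxA LL mul1mx. Qed.

Lemma frob_inner_mul_trr p q k (Q : 'M[R]_(p, q)) (B B' : 'M[R]_(k, q)) :
  Q^T *m Q = 1%:M -> frob_inner (B *m Q^T) (B' *m Q^T) = frob_inner B B'.
Proof. by move=> QQ; rewrite frob_inner_mulr trmxK -mulmxA QQ mulmx1. Qed.

(** The defect is the squared norm of [B - B *m L *m L^T], the part of the rows of [B] orthogonal to
    the columns of [L]. *)
Lemma sqnorm_mul_orthonormal_le p q k (L : 'M[R]_(p, q)) (B : 'M[R]_(k, p)) :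
  L^T *m L = 1%:M -> sqnorm (B *m L) <= sqnorm B.
Proof.
move=> LL; have := sqnorm_ge0 (B - B *m L *m L^T).
rewrite !frob_bilin frob_inner_mul_trr // (frob_innerC B).
rewrite frob_inner_mulr trmxK; lra.
Qed.

Lemma sqnorm_projC p k (P : 'M[R]_p) (B : 'M[R]_(p, k)) :
  P^T = P -> P *m P = P -> sqnorm (B - P *m B) = sqnorm B - sqnorm (P *m B).
Proof.
move=> PT PP; have PB : sqnorm (P *m B) = frob_inner (P *m B) B.
  by rewrite frob_inner_mull PT mulmxA PP -{1}PT -frob_inner_mull.
rewrite !frob_bilin (frob_innerC B (P *m B)) PB; ring.
Qed.

Lemma sqnorm_mul_diag_le p q (B : 'M[R]_(p, q)) (d e : 'rV[R]_q) :
  (forall l, d 0 l ^+ 2 <= e 0 l ^+ 2) ->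
  sqnorm (B *m diag_mx d) <= sqnorm (B *m diag_mx e).
Proof.
move=> de; rewrite !mul_mx_diag; do 2!apply: ler_sum => ? _; rewrite !mxE.
by rewrite -!expr2 !exprMn ler_wpM2l ?sqr_ge0.
Qed.

Lemma sqnorm_diag q (d : 'rV[R]_q) : sqnorm (diag_mx d) = \sum_l d 0 l ^+ 2.
Proof.
apply: eq_bigr => l _; rewrite (bigD1 l) //= mxE eqxx -expr2 big1 ?addr0 //.
by move=> l' /negPf ll'; rewrite mxE eq_sym ll' mul0r.
Qed.

Lemma frob_inner_sgn m (u : 'cV[R]_m) : frob_inner (sgn u) u = l1_norm u.
Proof.
by apply: eq_bigr => i _; rewrite big_ord1 mxE -normrEsg.
Qed.

Lemma frob_inner_sgn_le m (u v : 'cV[R]_m) : frob_inner (sgn u) v <= l1_norm v.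
Proof.
apply: ler_sum => i _; rewrite big_ord1 mxE (le_trans (ler_norm _)) //.
by rewrite normrM normr_sg ler_piMl // lern1 leq_b1.
Qed.

Lemma l1_norm_ge0 m (u : 'cV[R]_m) : 0 <= l1_norm u.
Proof. exact: sumr_ge0. Qed.

End Frobenius.

(** * Truncated singular value decompositions *)

Lemma sum_ltn_ord n k : (\sum_(l < n) (l < k) = minn n k)%N.
Proof.
elim: n => [|n IHn]; first by rewrite big_ord0 min0n.
by rewrite big_ord_recr /= IHn; lia.
Qed.

Lemma sqnorm_diag_prefix (R : realType) n k (c : R) :
  sqnorm (diag_mx (\row_(l < n) (c *+ (l < k)%N))) = c ^+ 2 * (minn n k)%:R.
Proof.
rewrite sqnorm_diag -sum_ltn_ord natr_sum mulr_sumr; apply: eq_bigr => l _.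
by rewrite mxE; case: (l < k)%N; rewrite ?mulr1 // expr0n mulr0.
Qed.

Section SingularValues.
Variables (R : realType) (N1 N2 : nat).
Implicit Types (Z W : 'M[R]_(N1, N2)) (p : pred nat).

(** Masking by a predicate makes the head, the tail [predC p] and, with [xpredT], the whole matrix
    instances of one construction. *)
Definition svd_mask Z (D : svd Z) p : 'rV[R]_(minn N1 N2) :=
  \row_l (svd_val D 0 l *+ p l).

Definition svd_part Z (D : svd Z) p : 'M[R]_(N1, N2) :=
  svd_left D *m diag_mx (svd_mask D p) *m (svd_right D)^T.

Lemma svd_partE Z (D : svd Z) p :
  svd_part D p = \sum_(l < minn N1 N2 | p l)
    svd_val D 0 l *: (col l (svd_left D) *m (col l (svd_right D))^T).
Proof.
apply/matrixP => i j; rewrite /svd_part mul_mx_diag !mxE summxE [RHS]big_mkcond /=.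
apply: eq_bigr => l _; rewrite !mxE; case: (p l); last by rewrite mulr0 mul0r.
by rewrite big_ord1 !mxE mulr1n mulrAC mulrC.
Qed.

Lemma svd_part_all Z (D : svd Z) : svd_part D xpredT = Z.
Proof. by rewrite svd_partE -svd_eq. Qed.

Lemma svd_val_diagE Z (D : svd Z) :
  (svd_left D)^T *m Z *m svd_right D = diag_mx (svd_val D).
Proof.
transitivity ((svd_left D)^T *m svd_part D xpredT *m svd_right D).
  by rewrite svd_part_all.
rewrite /svd_part !mulmxA svd_left_orthonormal mul1mx -mulmxA.
rewrite svd_right_orthonormal mulmx1; congr diag_mx.
by apply/rowP => l; rewrite mxE.
Qed.

Lemma hard_thrE (S : forall Z, svd Z) k Z :
  hard_thr S k Z = svd_part (S Z) (fun l => (l < k)%N).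
Proof. by rewrite svd_partE. Qed.

Lemma svd_partC Z (D : svd Z) p : Z - svd_part D p = svd_part D (predC p).
Proof.
rewrite -{1}(svd_part_all D) -mulmxBl -mulmxBr -raddfB /=.
congr (_ *m diag_mx _ *m _).
by apply/rowP => l; rewrite !mxE /=; case: (p l); rewrite ?subrr ?subr0.
Qed.

(** Complementary masks have product zero. Orthogonality of the row spaces is stronger than
    Frobenius orthogonality: it persists when the tail is multiplied on the left by a projection. *)
Lemma svd_partC_mul_tr Z (D : svd Z) p :
  svd_part D (predC p) *m (svd_part D p)^T = 0.
Proof.
rewrite !trmx_mul trmxK tr_diag_mx -!mulmxA (mulmxA (svd_right D)^T).
rewrite svd_right_orthonormal mul1mx (mulmxA (diag_mx _)) mulmx_diag.
rewrite [X in diag_mx X](_ : _ = 0) ?raddf0 /= ?mul0mx ?mulmx0 //.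
by apply/rowP => l; rewrite !mxE /=; case: (p l); rewrite ?mulr0 ?mul0r.
Qed.

Lemma frob_inner_svd_partC Z (D : svd Z) p :
  frob_inner (svd_part D p) (svd_part D (predC p)) = 0.
Proof.
by rewrite frob_innerE mxtrace_mulC svd_partC_mul_tr mxtrace0.
Qed.

Lemma sqnorm_svd_part Z (D : svd Z) p :
  sqnorm (svd_part D p) = \sum_l svd_mask D p 0 l ^+ 2.
Proof.
by rewrite frob_inner_mul_trr ?svd_right_orthonormal // sqnorm_mul_trl
  ?svd_left_orthonormal // sqnorm_diag.
Qed.

(** * Rank, singular values and column projections *)

Lemma rank_hard_thr (S : forall Z, svd Z) k Z : (\rank (hard_thr S k Z) <= k)%N.
Proof.
set D := S Z.
have -> : hard_thr S k Z =
    svd_left D *m (pid_mx k : 'M[R]_(minn N1 N2)) *m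
    (diag_mx (svd_val D) *m (svd_right D)^T).
  rewrite hard_thrE /svd_part !mulmxA -[in RHS](mulmxA (svd_left _)).
  congr (_ *m _ *m _); rewrite mul_mx_diag.
  apply/matrixP => i j; rewrite !mxE -val_eqE /=.
  case: eqP => [/val_inj->|_]; last by rewrite mul0r.
  by case: (j < k)%N; rewrite ?mul1r ?mul0r.
apply: leq_trans (mxrankM_maxl _ _) _; apply: leq_trans (mxrankM_maxr _ _) _.
rewrite -pid_mx_minv rank_pid_mx ?geq_minl //; exact: geq_minr.
Qed.

(** Otherwise the first [q.+1] singular values would be invertible, and [pid_mx q.+1], of rank
    [q.+1], would be a product with [Z] as a factor. *)
Lemma svd_val_eq0 Z (D : svd Z) q (l : 'I_(minn N1 N2)) :
  (\rank Z <= q <= l)%N -> svd_val D 0 l = 0.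
Proof.
case/andP => rZ ql; apply/eqP; rewrite eq_le svd_val_ge0 andbT leNgt.
apply/negP => l0.
have pos (l' : 'I_(minn N1 N2)) : (l' < q.+1)%N -> svd_val D 0 l' != 0.
  move=> l'q; rewrite gt_eqF // (lt_le_trans l0) // svd_val_noninc //.
  by rewrite (leq_trans _ ql).
have : (\rank (pid_mx q.+1 : 'M[R]_(minn N1 N2)) <= q)%N.
  have -> : pid_mx q.+1 = (svd_left D)^T *m Z *m (svd_right D *m
      diag_mx (\row_l' ((svd_val D 0 l')^-1 *+ (l' < q.+1)%N))).
    rewrite mulmxA svd_val_diagE mulmx_diag.
    apply/matrixP => i j; rewrite !mxE -val_eqE /=.
    case: eqP => [/val_inj->|//].
    by case: ltnP => [/pos j0|_]; rewrite ?mulr0 // !mulr1n divff.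
  apply: leq_trans (mxrankM_maxl _ _) _.
  by apply: leq_trans (mxrankM_maxr _ _) rZ.
by rewrite rank_pid_mx ?ltnn // (leq_ltn_trans ql).
Qed.

(** [P] projects onto the span of the first [q] left singular vectors (all of them if there are
    fewer), which contains the column space of [Z] because the later singular values vanish. Its
    squared norm is the number of those vectors. *)
Lemma ex_column_projection Z (D : svd Z) q : (\rank Z <= q)%N ->
  exists P : 'M[R]_N1,
    [/\ P^T = P, P *m P = P, P *m Z = Z & sqnorm P <= q%:R].
Proof.
move=> rZ; pose J := pid_mx q : 'M[R]_(minn N1 N2).
have JJ : J *m J = J by rewrite mul_pid_mx minnn pid_mx_minv.
exists (svd_left D *m J *m (svd_left D)^T); split.
- by rewrite !trmx_mul trmxK tr_pid_mx mulmxA.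
- rewrite !mulmxA -(mulmxA (_ *m J)) svd_left_orthonormal mulmx1.
  by rewrite -(mulmxA _ J J) JJ.
- suff : svd_left D *m J *m (svd_left D)^T *m svd_part D xpredT =
      svd_part D xpredT by rewrite svd_part_all.
  rewrite /svd_part !mulmxA -(mulmxA (_ *m J)).
  rewrite svd_left_orthonormal mulmx1 -(mulmxA _ J).
  congr (_ *m _ *m _); rewrite mul_mx_diag.
  apply/matrixP => i j; rewrite !mxE -val_eqE /=.
  case: eqP => [/val_inj->|_]; last by rewrite mul0r.
  case: ltnP => [_|qj]; rewrite ?mul1r // (@svd_val_eq0 _ _ q) ?rZ //.
  by rewrite mul0rn mulr0.
- rewrite frob_inner_mul_trr ?svd_left_orthonormal // sqnorm_mul_trl
    ?svd_left_orthonormal //.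
  have -> : J = diag_mx (\row_l (1 *+ (l < q)%N)).
    by apply/matrixP => i j; rewrite !mxE -val_eqE /=; case: eqP => [/val_inj->|].
  by rewrite sqnorm_diag_prefix expr1n mul1r ler_nat geq_minr.
Qed.


(* [tau] plays the role of the singular value of index [k], read as [0] when
   there is none. *)
Lemma ex_threshold Z (D : svd Z) k : exists tau : R,
  [/\ 0 <= tau, forall l : 'I_(minn N1 N2), (l < k)%N -> tau <= svd_val D 0 l,
      forall l : 'I_(minn N1 N2), (k <= l)%N -> svd_val D 0 l <= tau
    & tau = 0 \/ (k <= minn N1 N2)%N].
Proof.
have [kN|Nk] := ltnP k (minn N1 N2).
  exists (svd_val D 0 (Ordinal kN)); split; first exact: svd_val_ge0.
  - by move=> l lk; apply: svd_val_noninc; exact: ltnW.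
  - by move=> l kl; exact: svd_val_noninc.
  - by right; exact: ltnW.
exists 0; split=> //; first by move=> l _; exact: svd_val_ge0.
  by move=> l kl; have := leq_ltn_trans (leq_trans Nk kl) (ltn_ord l); rewrite ltnn.
by left.
Qed.

(** Raising every singular value to [tau] leaves [tau] times [P] times orthonormal columns. The
    bound thus depends on the norm of [P], not on the length of the tail. *)
Lemma sqnorm_mul_svd_tail_le Z (D : svd Z) k tau q (P : 'M[R]_N1) :
  sqnorm P <= q%:R ->
  (forall l : 'I_(minn N1 N2), (k <= l)%N -> svd_val D 0 l <= tau) ->
  sqnorm (P *m svd_part D (predC (fun l => l < k)%N)) <= q%:R * tau ^+ 2.
Proof.
move=> Pq tail; rewrite /svd_part mulmxA.
rewrite frob_inner_mul_trr ?svd_right_orthonormal // mulmxA.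
apply: le_trans (sqnorm_mul_diag_le _ (e := const_mx tau) _) _.
  move=> l; rewrite !mxE /=; case: ltnP => kl /=; first by rewrite expr0n sqr_ge0.
  have tau0 := le_trans (svd_val_ge0 D l) (tail l kl).
  by rewrite lerXn2r ?tail ?nnegrE ?svd_val_ge0.
rewrite diag_const_mx mul_mx_scalar !frob_bilin mulrA -expr2 mulrC.
apply: ler_wpM2r (sqr_ge0 _) _ _ _; apply: le_trans Pq.
exact/sqnorm_mul_orthonormal_le/svd_left_orthonormal.
Qed.

(** Each of the [k] leading values contributes at least [tau ^+ 2]; with fewer than [k] values,
    [tau] is 0 and the bound is trivial. *)
Lemma sqnorm_svd_head_ge Z (D : svd Z) k tau :
  0 <= tau -> (forall l : 'I_(minn N1 N2), (l < k)%N -> tau <= svd_val D 0 l) ->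
  tau = 0 \/ (k <= minn N1 N2)%N ->
  k%:R * tau ^+ 2 <= sqnorm (svd_part D (fun l => l < k)%N).
Proof.
move=> tau0 head kN; rewrite sqnorm_svd_part.
have -> : k%:R * tau ^+ 2 = tau ^+ 2 * (minn (minn N1 N2) k)%:R.
  by case: kN => [->|/minn_idPr->]; rewrite ?expr0n ?mulr0 ?mul0r // mulrC.
rewrite -sqnorm_diag_prefix sqnorm_diag; apply: ler_sum => l _; rewrite !mxE.
case: ltnP => [lk|_] //=; rewrite !mulr1n.
by rewrite lerXn2r ?head ?nnegrE ?svd_val_ge0.
Qed.

(* A weak form of the Eckart-Young theorem. *)
Lemma sqnorm_sub_low_rank_ge Z (D : svd Z) k tau q (P : 'M[R]_N1) X :
  P^T = P -> P *m P = P -> P *m X = X -> sqnorm P <= q%:R ->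
  0 <= tau -> (forall l : 'I_(minn N1 N2), (l < k)%N -> tau <= svd_val D 0 l) ->
  tau = 0 \/ (k <= minn N1 N2)%N ->
  (k%:R - q%:R) * tau ^+ 2 <= sqnorm (X - Z).
Proof.
move=> PT PP PX Pq tau0 head kN.
have -> : sqnorm (X - Z) = sqnorm (Z - X).
  by rewrite -opprB !frob_bilin; ring.
(* As [P] fixes [X], the matrix [Z - P *m Z] is [Z - X] with its component in the range of [P]
   removed. *)
apply: le_trans (_ : sqnorm (Z - P *m Z) <= _); last first.
  have -> : Z - P *m Z = (Z - X) - P *m (Z - X).
    by rewrite mulmxBr PX opprB addrA subrK.
  by rewrite sqnorm_projC // gerBl sqnorm_ge0.
pose B d := svd_left D *m diag_mx d.
have -> : sqnorm (Z - P *m Z) = sqnorm ((1%:M - P) *m B (svd_mask D xpredT)).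
  transitivity (sqnorm (svd_part D xpredT - P *m svd_part D xpredT)).
    by rewrite svd_part_all.
  rewrite /svd_part mulmxA -mulmxBl frob_inner_mul_trr ?svd_right_orthonormal //.
  by rewrite mulmxBl mul1mx.
(* Lowering the first [k] singular values to [tau] and the others to 0 gives squared norm [k tau^2],
   of which [P] captures at most [q tau^2]. *)
pose e := \row_(l < minn N1 N2) (tau *+ (l < k)%N).
apply: le_trans (_ : sqnorm ((1%:M - P) *m B e) <= _); last first.
  rewrite /B !mulmxA; apply: sqnorm_mul_diag_le => l; rewrite !mxE mulr1n.
  case: ltnP => [lk|_]; last by rewrite expr0n sqr_ge0.
  by rewrite mulr1n lerXn2r ?head ?nnegrE ?svd_val_ge0.
rewrite mulmxBl mul1mx sqnorm_projC // mulrBl lerB //.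
  rewrite sqnorm_mul_trl ?svd_left_orthonormal // sqnorm_diag_prefix.
  by case: kN => [->|/minn_idPr->]; rewrite ?expr0n ?mulr0 ?mul0r // mulrC.
rewrite /B mulmxA; apply: le_trans (sqnorm_mul_diag_le _ (e := const_mx tau) _) _.
  by move=> l; rewrite !mxE; case: ltnP => //=; rewrite expr0n sqr_ge0.
rewrite diag_const_mx mul_mx_scalar !frob_bilin mulrA -expr2 mulrC.
apply: ler_wpM2r (sqr_ge0 _) _ _ _; apply: le_trans Pq.
exact/sqnorm_mul_orthonormal_le/svd_left_orthonormal.
Qed.

(** * Near-optimality of hard thresholding and the effect of its tail *)

Lemma hard_thr_near_best (S : forall Z, svd Z) s r (eta : R) X Z :
  (\rank X <= r)%N -> 0 < eta -> r%:R <= eta ^+ 2 * (s%:R - r%:R) ->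
  (1 - eta) * sqnorm (X - hard_thr S s Z) <= (1 + eta) * sqnorm (X - Z).
Proof.
move=> rX eta0 sr; have [P [PT PP PX Pr]] := ex_column_projection (S X) rX.
have [tau [tau0 head tail kN]] := ex_threshold (S Z) s.
have lower := sqnorm_sub_low_rank_ge PT PP PX Pr tau0 head kN.
have := sqnorm_mul_svd_tail_le Pr tail.
rewrite -svd_partC -hard_thrE; set V := hard_thr S s Z; set W := Z - V => upper.
have VW : frob_inner V W = 0.
  by rewrite /W /V hard_thrE svd_partC frob_inner_svd_partC.
have VPW : frob_inner V (P *m W) = 0.
  rewrite frob_innerE mxtrace_mulC /W /V hard_thrE svd_partC -mulmxA.
  by rewrite svd_partC_mul_tr mulmx0 mxtrace0.
have XZW : X - Z = (X - V) - W by rewrite /W opprB addrA subrK.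
clearbody W.
have XW : frob_inner X W = frob_inner (X - V) (P *m W).
  by rewrite !frob_bilin VPW subr0 -{1}PX frob_inner_mull PT.
have XZ : sqnorm (X - Z) = sqnorm (X - V) - 2 * frob_inner X W + sqnorm W.
  by rewrite XZW !frob_bilin (frob_innerC W X) (frob_innerC W V) VW; ring.
have amgm := frob_inner_le_weighted (X - V) (P *m W) eta0.
(* This is the chain [|P W|^2 <= r tau^2 <= eta^2 (s - r) tau^2 <= eta^2 |X - Z|^2]. *)
have : eta^-1 * sqnorm (P *m W) <= eta * sqnorm (X - Z).
  rewrite mulrC ler_pdivrMr // (le_trans upper) //.
  apply: le_trans (ler_wpM2r (sqr_ge0 tau) sr) _.
  by rewrite -mulrA [leRHS]mulrAC -expr2 ler_wpM2l ?sqr_ge0.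
rewrite -XW in amgm; have := sqnorm_ge0 W; lra.
Qed.

(** A projection [P] fixing [Z] can be moved onto the tail, and Cauchy-Schwarz leaves [|P (G -
    H_t(G))|^2 <= q tau^2 <= c^2 t tau^2 <= c^2 |H_t(G)|^2]. *)
Lemma frob_inner_hard_thr_tail_le (S : forall Z, svd Z) t q (c : R) G Z :
  (\rank Z <= q)%N -> 0 <= c -> q%:R <= c ^+ 2 * t%:R ->
  frob_inner (G - hard_thr S t G) Z <=
    c * frob_norm (hard_thr S t G) * frob_norm Z.
Proof.
move=> rZ c0 qt; have [P [PT PP PZ Pq]] := ex_column_projection (S Z) rZ.
have [tau [tau0 head tail kN]] := ex_threshold (S G) t.
have := sqnorm_mul_svd_tail_le Pq tail; have := sqnorm_svd_head_ge tau0 head kN.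
rewrite -svd_partC -hard_thrE => lower upper.
rewrite -{1}PZ frob_innerC frob_inner_mull PT frob_innerC.
apply: le_trans (frob_cauchy_schwarz _ _) _.
apply: ler_wpM2r (frob_norm_ge0 _) _ _ _.
rewrite -(@ler_pXn2r _ 2) ?nnegrE ?mulr_ge0 ?frob_norm_ge0 //.
rewrite exprMn !sqr_frob_norm (le_trans upper) //.
apply: le_trans (ler_wpM2l (sqr_ge0 c) lower).
by rewrite [leRHS]mulrA ler_wpM2r ?sqr_ge0.
Qed.

End SingularValues.

(** * Optimal isometry constants and geometric convergence *)

Lemma rank_rip_bounds (R : realType) N1 N2 m
    (A : 'M[R]_(N1, N2) -> 'cV[R]_m) k :
  (0 < N1)%N -> (0 < N2)%N -> (0 < k)%N -> rank_rip A k ->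
  [/\ 0 < rip_alpha A k,
      forall Z, (\rank Z <= k)%N -> rip_alpha A k * frob_norm Z <= l1_norm (A Z)
    & forall Z, (\rank Z <= k)%N -> l1_norm (A Z) <= rip_beta A k * frob_norm Z].
Proof.
case: N1 A => // N1 A _; case: N2 A => // N2 A _ k0 [a [b [aA bA]]].
split.
- apply: lt_le_trans (ub_le_sup _ aA); first by case: aA.
  (* A nonzero matrix of rank one, available since the dimensions and [k] are positive, bounds all
     lower constants, so the supremum is genuine. *)
  pose E : 'M[R]_(N1.+1, N2.+1) := delta_mx 0 0.
  have rE : (\rank E <= k)%N by rewrite mxrank_delta.
  have E0 : 0 < frob_norm E.
    rewrite frob_norm_gt0; apply/eqP => /matrixP/(_ 0 0)/eqP.
    by rewrite !mxE !eqxx oner_eq0.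
  exists (l1_norm (A E) / frob_norm E) => a' [_ a'A].
  by rewrite ler_pdivlMr // a'A.
- move=> Z rZ; have [->|] := eqVneq Z 0.
    by rewrite frob_norm0 mulr0 l1_norm_ge0.
  rewrite -frob_norm_gt0 => Z0; rewrite -ler_pdivlMr //.
  apply: ge_sup; first by exists a.
  by move=> a' [_ a'A]; rewrite ler_pdivlMr // a'A.
- move=> Z rZ; have [->|] := eqVneq Z 0.
    case: bA => _ /(_ 0); rewrite frob_norm0 !mulr0; apply.
    by rewrite mxrank0.
  rewrite -frob_norm_gt0 => Z0; rewrite -ler_pdivrMr //.
  apply: lb_le_inf; first by exists b.
  by move=> b' [_ b'A]; rewrite ler_pdivrMr // b'A.
Qed.

Lemma cvg_sqnorm_geometric (R : realType) N1 N2 (u : nat -> 'M[R]_(N1, N2)) X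
    (rho c : R) :
  0 <= rho < 1 -> (forall n, sqnorm (X - u n) <= rho ^+ n * c) ->
  u n @[n --> \oo] --> X.
Proof.
case/andP => rho0 rho1 ub; apply/cvg_ballP => e e0.
have : geometric c rho @ \oo --> 0 by apply: cvg_geometric; rewrite ger0_norm.
(* Matrix balls are entrywise and each squared entry is at most [sqnorm]; hence the radius [e ^+ 2]
   for the geometric bound. *)
move=> /cvgrPdist_lt/(_ _ (exprn_gt0 2 e0)) [n0 _ H].
exists n0 => // n /H /=; rewrite sub0r normrN => lt_e; split=> // i j.
rewrite /ball /= -(@ltr_pXn2r _ 2) ?nnegrE ?(ltW e0) // real_normK ?num_real //.
apply: le_lt_trans (le_lt_trans (ler_norm _) lt_e).
rewrite mulrC (le_trans _ (ub n)) //.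
by have := sqr_entry_le_sqnorm (X - u n) i j; rewrite !mxE.
Qed.

(** * Contraction of one step *)

Section Contraction.
Variables (R : realType) (N1 N2 m : nat).
Variables (A : {linear 'M[R]_(N1, N2) -> 'cV[R]_m}).
Variables (Aadj : 'cV[R]_m -> 'M[R]_(N1, N2)).
Variables (S : forall Z : 'M[R]_(N1, N2), svd Z).
Variables (alpha beta gamma : R) (q t : nat).
Hypothesis adjA : is_adjoint A Aadj.
Hypothesis gamma_ge1 : 1 <= gamma.
Hypothesis alpha_gt0 : 0 < alpha.
Hypothesis beta_le : beta <= gamma * alpha.
Hypothesis lowerA : forall Z : 'M[R]_(N1, N2),
  (\rank Z <= q)%N -> alpha * frob_norm Z <= l1_norm (A Z).
Hypothesis upperA : forall Z : 'M[R]_(N1, N2),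
  (\rank Z <= t)%N -> l1_norm (A Z) <= beta * frob_norm Z.
Hypothesis q_le_t : 16 * gamma ^+ 2 * q%:R <= t%:R.

Local Notation dir Z := (hard_thr S t (Aadj (sgn (A Z)))).

Lemma frob_norm_dir_le Z : frob_norm (dir Z) <= gamma * alpha.
Proof.
have [d0|] := eqVneq (dir Z) 0.
  rewrite d0 frob_norm0 mulr_ge0 ?(ltW alpha_gt0) //.
  exact: le_trans gamma_ge1.
rewrite -frob_norm_gt0 => d0; apply: le_trans beta_le.
rewrite -(ler_pM2r d0) -expr2 sqr_frob_norm.
apply: le_trans (upperA (rank_hard_thr S t _)).
apply: le_trans (frob_inner_sgn_le (A Z) _); rewrite -adjA.
set G := Aadj _.
have tail0 : frob_inner (hard_thr S t G) (G - hard_thr S t G) = 0.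
  by rewrite hard_thrE svd_partC frob_inner_svd_partC.
by rewrite (frob_innerC G) -{4}(subrK (hard_thr S t G) G) frob_innerDr tail0 add0r.
Qed.

Lemma frob_inner_dir_ge Z : (\rank Z <= q)%N ->
  3 / 4 * l1_norm (A Z) <= frob_inner (dir Z) Z.
Proof.
move=> rZ; have g0 : 0 < gamma by apply: lt_le_trans gamma_ge1.
set G := Aadj (sgn (A Z)).
have GZ : frob_inner G Z = l1_norm (A Z) by rewrite adjA frob_inner_sgn.
(* With [|dir Z| <= gamma alpha] and [alpha |Z| <= |A Z|_1], the coefficient [1 / (4 gamma)] makes
   the tail cost at most a quarter of [|A Z|_1]; its square explains the 16 in [q_le_t]. *)
have c0 : 0 <= (4 * gamma)^-1 by rewrite invr_ge0 mulr_ge0 // ltW.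
have qt : q%:R <= (4 * gamma)^-1 ^+ 2 * t%:R.
  rewrite exprVn mulrC ler_pdivlMr ?exprn_gt0 ?mulr_gt0 //.
  by move: q_le_t; lra.
have := frob_inner_hard_thr_tail_le S G rZ c0 qt.
rewrite frob_innerDl frob_innerNl GZ.
have : (4 * gamma)^-1 * frob_norm (dir Z) * frob_norm Z <= l1_norm (A Z) / 4.
  have -> : (4 * gamma)^-1 * frob_norm (dir Z) * frob_norm Z =
      frob_norm (dir Z) * frob_norm Z / gamma / 4 by field; rewrite gt_eqF.
  rewrite ler_pM2r // ler_pdivrMr //.
  apply: le_trans (ler_wpM2r (frob_norm_ge0 Z) (frob_norm_dir_le Z)) _.
  by rewrite -mulrA mulrC ler_pM2r // lowerA.
lra.
Qed.

Lemma iht_gradient_step_contracts (X Y : 'M[R]_(N1, N2)) :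
  (\rank (X - Y)%R <= q)%N ->
  sqnorm (X - (Y + iht_step A Aadj S (A X) t Y *: iht_dir A Aadj S (A X) t Y))
    <= (1 - (2 * gamma ^+ 2)^-1) * sqnorm (X - Y).
Proof.
rewrite opprD addrA /iht_step /iht_dir.
have -> : A X - A Y = A (X - Y) by rewrite linearB.
move: (X - Y) => Z rZ.
have g0 : 0 < gamma by apply: lt_le_trans gamma_ge1.
have dZ := frob_inner_dir_ge rZ; have lZ := lowerA rZ.
(* A zero direction forces [A Z = 0], hence [Z = 0] by the lower isometry bound: the gradient step
   stalls only at the solution. *)
have [d0|] := eqVneq (dir Z) 0.
  rewrite d0 scaler0 subr0; suff -> : Z = 0.
    by rewrite -(scale0r 0) frob_innerZl mul0r mulr0.
  apply/eqP; move: dZ; apply: contraTT; rewrite -frob_norm_gt0 => Z0.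
  rewrite d0 -(scale0r 0) frob_innerZl mul0r -ltNge.
  by rewrite mulr_gt0 // (lt_le_trans _ lZ) // mulr_gt0.
rewrite -frob_norm_gt0 => d0; have dle := frob_norm_dir_le Z.
(* With [mu = a / h^2], the expansion [|Z|^2 - 2 mu <dir Z, Z> + mu^2 h^2] is at most
   [|Z|^2 - (a / h)^2 / 2], and [a / h >= |Z| / gamma]. *)
set a := l1_norm _ in dZ lZ *; set h := frob_norm (dir Z) in d0 dle *.
have a0 : 0 <= a := l1_norm_ge0 _.
rewrite !frob_bilin (frob_innerC Z) -(sqr_frob_norm (dir Z)) -/h -(sqr_frob_norm Z).
have : (frob_norm Z / gamma) ^+ 2 <= (a / h) ^+ 2.
  rewrite lerXn2r ?nnegrE ?divr_ge0 ?frob_norm_ge0 ?(ltW g0) ?(ltW d0) //.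
  rewrite ler_pdivlMr // mulrAC ler_pdivrMr // mulrC.
  apply: le_trans (ler_wpM2r (frob_norm_ge0 Z) dle) _.
  by rewrite -mulrA mulrC ler_pM2r.
have : (a / h ^+ 2) * (3 / 4 * a) <= (a / h ^+ 2) * frob_inner (dir Z) Z.
  by rewrite ler_wpM2l // divr_ge0 // sqr_ge0.
have -> : (a / h ^+ 2) * (3 / 4 * a) = 3 / 4 * (a / h) ^+ 2 by field; rewrite gt_eqF.
rewrite mulrN.
have -> : a / h ^+ 2 * (a / h ^+ 2 * h ^+ 2) = (a / h) ^+ 2 by field; rewrite gt_eqF.
have -> : (1 - (2 * gamma ^+ 2)^-1) * frob_norm Z ^+ 2 =
  frob_norm Z ^+ 2 - (frob_norm Z / gamma) ^+ 2 / 2 by field; rewrite gt_eqF.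
lra.
Qed.

End Contraction.

(** * Choice of constants and geometric decay of the error *)

Theorem theorem1 (R : realType) (gamma : R) (gamma_ge1 : 1 <= gamma) :
  exists c0 c1 c2 : nat, [/\ (0 < c0)%N, (0 < c1)%N, (0 < c2)%N &
    forall (N1 N2 m r : nat),
      (0 < N1)%N -> (0 < N2)%N -> (0 < m)%N -> (0 < r)%N ->
    forall (A : {linear 'M[R]_(N1, N2) -> 'cV[R]_m})
           (Aadj : 'cV[R]_m -> 'M[R]_(N1, N2))
           (S : forall Z : 'M[R]_(N1, N2), svd Z),
      is_adjoint A Aadj ->
      rank_rip A (c0 * r) ->
      rip_ratio A (c0 * r) <= gamma ->
    forall X : 'M[R]_(N1, N2), (\rank X <= r)%N ->
      iht A Aadj S (A X) (c1 * r) (c2 * r) n @[n --> \oo] --> X].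
Proof.
have g0 : 0 < gamma by apply: lt_le_trans gamma_ge1.
have g2 : 1 <= gamma ^+ 2 by rewrite expr_ge1 // ltW.
(* This makes the gradient-step factor [1 - 4 eta], small enough to absorb the thresholding factor
   [(1 + eta) / (1 - eta)]. *)
pose eta : R := (8 * gamma ^+ 2)^-1.
have eta0 : 0 < eta by rewrite invr_gt0 mulr_gt0 ?exprn_gt0.
have eta8 : eta <= 1 / 8.
  by rewrite div1r lef_pV2 ?posrE ?mulr_gt0 ?exprn_gt0 //; lra.
have etaE : (2 * gamma ^+ 2)^-1 = 4 * eta by rewrite /eta; field; rewrite gt_eqF.
have B1 : 0 <= 1 + eta ^- 2 by rewrite addr_ge0 // invr_ge0 exprn_ge0 // ltW.
(* Ensures [r <= eta^2 (c1 r - r)], as near-optimal thresholding requires. *)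
pose c1 := Num.bound (1 + eta ^- 2).
have c1P : 1 + eta ^- 2 <= c1%:R by rewrite ltW ?archi_boundP.
have B2 : 0 <= 16 * gamma ^+ 2 * (1 + c1)%:R.
  by rewrite mulr_ge0 // mulr_ge0 // exprn_ge0 // ltW.
(* The errors [X - X_n] have rank at most [(1 + c1) r]; this is [q_le_t] for that rank and
   [t = c2 r]. *)
pose c2 := Num.bound (16 * gamma ^+ 2 * (1 + c1)%:R).
have c2P : 16 * gamma ^+ 2 * (1 + c1)%:R <= c2%:R by rewrite ltW ?archi_boundP.
(* The order must cover the rank [(1 + c1) r] of the errors and the rank [c2 r] of the
   directions. *)
exists (1 + c1 + c2)%N, c1, c2; split=> //.
move=> N1 N2 m r N10 N20 _ r0 A Aadj S adjA rip ratio X rX.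
have c0r : (0 < (1 + c1 + c2) * r)%N by rewrite muln_gt0.
have [a0 lowA upA] := rank_rip_bounds N10 N20 c0r rip.
rewrite /rip_ratio ler_pdivrMr // in ratio.
have rank_iht n : (\rank (X - iht A Aadj S (A X) (c1 * r) (c2 * r) n)%R
    <= (1 + c1) * r)%N.
  rewrite mulnDl mul1n (leq_trans (mxrank_add _ _)) // leq_add // mxrank_opp.
  by case: n => [|n]; rewrite ?mxrank0 //= rank_hard_thr.
(* [rho < 1] since [(1 + eta) (1 - 4 eta) <= 1 - 3 eta]. *)
pose rho := (1 - 3 * eta) / (1 - eta).
apply: (@cvg_sqnorm_geometric _ _ _ _ _ rho (sqnorm X)).
  rewrite divr_ge0 ?ltr_pdivrMr ?mul1r; lra.
elim=> [|n IHn]; first by rewrite expr0 mul1r subr0.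
set Y := iht _ _ _ _ _ _ n in IHn *.
set U := Y + iht_step A Aadj S (A X) (c2 * r) Y *:
  iht_dir A Aadj S (A X) (c2 * r) Y.
have step : sqnorm (X - U) <= (1 - 4 * eta) * sqnorm (X - Y).
  rewrite -etaE.
  apply: (iht_gradient_step_contracts S adjA gamma_ge1 a0 ratio _ _ _ (rank_iht n)).
  - by move=> Z rZ; apply: lowA; rewrite (leq_trans rZ) // leq_mul2r leq_addr orbT.
  - by move=> Z rZ; apply: upA; rewrite (leq_trans rZ) // leq_mul2r leq_addl orbT.
  - by rewrite !natrM mulrA ler_wpM2r.
have thr : (1 - eta) * sqnorm (X - hard_thr S (c1 * r) U) <=
    (1 + eta) * sqnorm (X - U).
  apply: (hard_thr_near_best S U rX eta0).
  rewrite natrM -{3}(mul1r r%:R) -mulrBl mulrA -{1}(mul1r r%:R) ler_wpM2r //.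
  rewrite -ler_pdivrMl ?exprn_gt0 // mulr1; lra.
have Y0 := sqnorm_ge0 (X - Y); have eta1 : 0 < 1 - eta by lra.
rewrite exprS -mulrA [iht _ _ _ _ _ _ _]/= -/Y -/U -(ler_pM2l eta1).
apply: le_trans thr _.
rewrite (mulrA (1 - eta) rho) (mulrC (1 - eta) rho) divfK ?gt_eqF //.
apply: le_trans (_ : (1 - 3 * eta) * sqnorm (X - Y) <= _); last first.
  by rewrite ler_wpM2l //; lra.
have eta1' : 0 <= 1 + eta by lra.
apply: le_trans (ler_wpM2l eta1' step) _; rewrite mulrA ler_wpM2r //; nra.
Qed.
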